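(* The rB-hole Search problem can be solved on an $n$-node ring with arbitrarily high constant probability using $O(1)$ agents and $O(n\log n)$ moves. That is, for every constant $\delta>0$ there is a protocol for rB-hole Search on the $n$-node ring that reports the correct location with probability at least $1-\delta$ and uses $O(1)$ agents and $O(n\log n)$ moves (where the lower bound $p$ on the killing probability is a fixed constant).
   Context: Network and agents. The network is the cycle (ring) on $n$ nodes, which may be anonymous. Agents are computational entities with bounded local memory that move along links between adjacent nodes and run a common protocol. Every node carries a whiteboard: a shared memory of $O(\log n)$ bits that agents at that node can read and write in mutual exclusion; whiteboards are the only means of communication. Agents are asynchronous: each action (computation step or move on a link) takes finite but unpredictable time, with no bound. All agents start at a common safe node $h$, the homebase. Numbers of moves and agents are worst-case totals. rB-hole. An rB-hole is located at a node and has a killing probability: (1) when an agent moves from a safe node to the rB-hole, a biased coin is flipped and the agent is killed with that probability, leaving no observable trace; (2) if it survives, it accesses the whiteboard of that node and can safely modify it; (3) when it moves from the rB-hole to a safe node, another coin is flipped and it is killed with the same probability, otherwise it leaves safely. Problem. It is given that exactly one node (different from $h$) contains the rB-hole. The rB-hole Search problem asks for a protocol coordinating the agents so that after a finite number of moves at least one agent survives and reports the location of the rB-hole; the output may be wrong with a bounded error probability. Every agent knows the full topology of the graph and knows a lower bound $p$, $0<p\le 1$, on the killing probability. *)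

(* Defs.v *)
From mathcomp Require Import all_boot all_order all_algebra.
From mathcomp Require Import reals.

Set Implicit Arguments.
Unset Strict Implicit.
Unset Printing Implicit Defensive.

Import Order.TTheory GRing.Theory Num.Theory.
Local Open Scope ring_scope.

(* The nodes of the ring are 'I_n; they are anonymous to the agents, which only
   see the two ports [true] and [false] of the node they are at. The ports need
   not be labelled consistently: [cw_port v] is the one leading from v to its
   clockwise neighbour ordS v, and is unknown to the agents. *)
Record network (n : nat) := Network {
  home : 'I_n;
  hole : 'I_n;
  cw_port : 'I_n -> bool
}.

Definition neighbour (n : nat) (v : 'I_n) (cw : bool) : 'I_n :=
  if cw then ordS v else ord_pred v.

(* The node reached from the homebase by leaving through port [x] and then
   following [d] links in that direction: the way an agent of an anonymous ring
   names a node. *)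
Definition site (n : nat) (N : network n) (x : bool) (d : nat) : 'I_n :=
  iter d (fun v => neighbour v (x == cw_port N (home N))) (home N).

Inductive act :=
  | Wait
  | Go of bool
  | Report of bool & nat.

(* The common program of the agents. One application of [trans] is one access
   in mutual exclusion to the whiteboard of the current node: it maps the local
   memory, the port through which the agent entered the node (None if it has not
   moved yet) and the contents of the whiteboard to the new local memory, the
   new contents and what the agent does next. *)
Record protocol := Protocol {
  memory : finType;
  board : finType;
  start : memory;
  blank : board;
  trans : memory -> option bool -> board -> memory * board * act
}.

(* [Transit s v cw]: on the link from v to [neighbour v cw].
   [Reported x d]: alive, and has terminated naming the hole [site N x d]. *)
Inductive agent (n : nat) (P : protocol) :=
  | At of memory P & 'I_n & option bool
  | Transit of memory P & 'I_n & bool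
  | Killed
  | Reported of bool & nat.
Arguments At {n P}.
Arguments Transit {n P}.
Arguments Killed {n P}.
Arguments Reported {n P}.

(* [moves] counts the links entered so far by all the agents together,
   including the traversals that turn out to be fatal. *)
Record config (n k : nat) (P : protocol) := Config {
  boards : {ffun 'I_n -> board P};
  agents : {ffun 'I_k -> agent n P};
  moves : nat
}.

Definition init (n k : nat) (N : network n) (P : protocol) : config n k P :=
  Config [ffun=> blank P] [ffun=> At (start P) (home N) None] 0.

Definition upd (I : finType) (T : Type) (f : {ffun I -> T}) (i : I) (x : T) :
    {ffun I -> T} :=
  [ffun j => if j == i then x else f j].

(* One action of agent i. The coin [b] ([true] = killed) matters only when i
   completes the traversal of a link incident to the hole, in either direction;
   completing a traversal and then accessing the whiteboard are two actions. *)
Definition step (n k : nat) (N : network n) (P : protocol) (c : config n k P)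
    (i : 'I_k) (b : bool) : config n k P :=
  match agents c i with
  | At s v e =>
      let: (s', w, a) := trans s e (boards c v) in
      let bs := upd (boards c) v w in
      match a with
      | Wait => Config bs (upd (agents c) i (At s' v e)) (moves c)
      | Go x =>
          Config bs (upd (agents c) i (Transit s' v (x == cw_port N v)))
                 (moves c).+1
      | Report x d => Config bs (upd (agents c) i (Reported x d)) (moves c)
      end
  | Transit s v cw =>
      let u := neighbour v cw in
      let entry := if cw then ~~ cw_port N u else cw_port N u in
      let killed := ((v == hole N) || (u == hole N)) && b in
      Config (boards c)
             (upd (agents c) i (if killed then Killed else At s u (Some entry)))
             (moves c)
  | Killed | Reported _ _ => c
  end.

(* An asynchronous adaptive adversary: it chooses the agent that acts next from
   the whole past. The past is represented by the coins already flipped, one per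
   action, latest first; they determine the execution so far. *)
Definition scheduler (k : nat) := seq bool -> 'I_k.

Fixpoint run (n k : nat) (N : network n) (P : protocol) (S : scheduler k)
    (w : seq bool) : config n k P :=
  match w with
  | [::] => init k N P
  | b :: w' => step N (run N P S w') (S w') b
  end.

Definition inactive (n k : nat) (P : protocol) (c : config n k P) (i : 'I_k) :
    bool :=
  match agents c i with
  | Killed | Reported _ _ => true
  | _ => false
  end.

(* Every action takes finite time: in every infinite execution, an agent that is
   neither killed nor terminated eventually acts again. *)
Definition fair (n k : nat) (N : network n) (P : protocol) (S : scheduler k) :
    Prop :=
  forall (w : nat -> bool) (i : 'I_k) (t : nat), exists t' : nat,
    (t <= t')%N /\
    (S (rev (mkseq w t')) = i \/ inactive (run N P S (rev (mkseq w t'))) i).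

Definition reports_right (n k : nat) (N : network n) (P : protocol)
    (c : config n k P) (i : 'I_k) : bool :=
  if agents c i is Reported x d then site N x d == hole N else false.

Definition reports_wrong (n k : nat) (N : network n) (P : protocol)
    (c : config n k P) (i : 'I_k) : bool :=
  if agents c i is Reported x d then site N x d != hole N else false.

Definition success (n k : nat) (N : network n) (P : protocol)
    (c : config n k P) : bool :=
  [exists i, reports_right N c i] && ~~ [exists i, reports_wrong N c i].

(* Probability that the first t coins satisfy E, the coins being independent and
   equal to [true] with probability q. *)
Definition prob (R : realType) (q : R) (t : nat) (E : pred (seq bool)) : R :=
  \sum_(w : t.-tuple bool | E w) \prod_(b <- w) (if b then q else 1 - q).

(* Main.v *)
Require Import Defs.
From mathcomp Require Import all_boot all_order all_algebra.
From mathcomp Require Import reals boolp zify ring lra.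
Import Order.TTheory GRing.Theory Num.Theory.

Set Implicit Arguments.
Unset Strict Implicit.
Unset Printing Implicit Defensive.

(* Two agents explore the ring from the homebase in opposite directions. An
   agent declares a node safe only after m+1 round trips to it, so that the hole
   is declared safe with probability at most 2(1-p)^(2m+2); otherwise the hole
   acts as a black hole. The unexplored arc is divided between the agents; the
   agent whose share contains the hole cannot finish it, so the other one
   eventually does. The finisher then walks through safe nodes to the frontier
   of its companion, leaves there a new limit that halves what remains, and goes
   back to work; when a single node remains, that node is the hole. There are
   about log n divisions, each costing O(n) moves. *)

(** * The protocol *)

(** Once the hole has been declared safe, the agents may walk through it and the invariant fails.
    Two devices confine that case: every agent carries a finite supply [F] of moves, so the move
    bound holds on all executions; and termination and correctness are proved only while the hole
    has not been declared safe, where the supply is shown to suffice. The scheduler adapts to past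
    coins, so the crossings of the hole are not a family of coins fixed in advance. Each agent
    therefore gets the weight (1-q)^j, where j counts the traversals of a link of the hole that it
    must still survive before it can declare the hole safe. The sum of the weights behaves as a
    supermartingale under every scheduler and starts at 2(1-q)^(2m+2), one term per agent. *)

Section Protocol.
Variables n m F : nat.

(* The first component tells whether an agent has already registered. The slot
   of port [x] of the homebase, at the node [site N x d], says whether
   [site N x d.+1] has been declared safe, and holds the last node that the
   explorer of that side has to explore (0: no limit left there). *)
Definition whiteboard : finType := (bool * {ffun bool -> bool * 'I_n.+1})%type.

(* [inl (x, y, o, d, l)]: the agent that explores side [x] walks at distance [d]
   on side [y], outwards if [o]; it believes that its limit is [l].
   [inr (x, d, r)]: it is testing the node [site N x d.+1] and has [r] more
   traversals of the link to that node to make before declaring it safe. *)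
Definition task : finType :=
  (bool * bool * bool * 'I_n.+1 * 'I_n.+1 + bool * 'I_n.+1 * 'I_(m.*2.+2))%type.

Definition walk (x y o : bool) (d l : nat) : option task :=
  Some (inl (x, y, o, inord d, inord l)).

Definition test (x : bool) (d r : nat) : option task :=
  Some (inr (x, inord d, inord r)).

Definition write (b : whiteboard) (y mk : bool) (l : nat) : whiteboard :=
  (b.1, upd b.2 y (mk, inord l)).

Definition turn (x y : bool) (d l : nat) (back : bool) (b : whiteboard) :
    option task * whiteboard * act :=
  if d is d'.+1 then (walk x y false d' l, b, Go back)
  else (walk x (~~ y) true 0 l, b, Wait).

Lemma turn0 x y d l back b : d = 0 ->
  turn x y d l back b = (walk x (~~ y) true 0 l, b, Wait).
Proof. by move=> ->. Qed.

Lemma turnS x y d l back b d' : d = d'.+1 ->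
  turn x y d l back b = (walk x y false d' l, b, Go back).
Proof. by move=> ->. Qed.

(* The other frontier is reached only after exploring up to the limit, so that
   [u] is then the number of nodes not yet declared safe. *)
Definition walk_out (x y : bool) (d l : nat) (back : bool) (b : whiteboard) :
    option task * whiteboard * act :=
  let fwd := if d == 0 then y else ~~ back in
  let mk := (b.2 y).1 in
  let msg := val (b.2 y).2 in
  if mk then (walk x y true d.+1 l, b, Go fwd)
  else if y == x then
    let l' := if msg == 0 then l else msg in
    if d < l' then (test x d m.*2.+1, write b y false l', Go fwd)
    else turn x y d l' back b
  else
    let u := n.-1 - d - l in
    if u <= 1 then (walk x y true d l, b, Report y d.+1)
    else turn x y d (l + u./2) back (write b y false (d + uphalf u)).

Definition walk_in (x y : bool) (d l : nat) (back : bool) (b : whiteboard) :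
    option task * whiteboard * act :=
  if d is d'.+1 then (walk x y false d' l, b, Go (~~ back))
  else (walk x (~~ y) true 0 l, b, Wait).

(** The entry port always leads to the other end of the tested link, so one instruction serves both
    directions and the final advance. The limit is read back from the whiteboard because the
    companion may have changed it during the test. *)
Definition test_step (x : bool) (d r : nat) (back : bool) (b : whiteboard) :
    option task * whiteboard * act :=
  if r is r'.+1 then (test x d r', b, Go back)
  else (walk x x true d.+1 (val (b.2 x).2), write b x true 0, Go back).

(** The default of [back] occurs only before the first move, at the homebase, where the instructions
    at distance 0 do not read it. *)
Definition brain (s : option task) (e : option bool) (b : whiteboard) :
    option task * whiteboard * act :=
  let back := odflt true e in
  match s with
  | None => (walk (~~ b.1) (~~ b.1) true 0
               (if b.1 then uphalf n.-1 else n.-1./2), (true, b.2), Wait)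
  | Some (inl (x, y, o, d, l)) =>
      if o then walk_out x y d l back b else walk_in x y d l back b
  | Some (inr (x, d, r)) => test_step x d r back b
  end.

(* The second component of the memory is the number of moves that the agent may
   still make: it bounds the moves also when the hole has been declared safe. *)
Definition ring_search : protocol :=
  @Protocol (option task * 'I_F.+1)%type whiteboard
    (None, ord_max) (false, [ffun=> (false, ord0)])
    (fun s e b =>
       let: (s', b', a) := brain s.1 e b in
       if a is Go _ then
         if s.2 == 0 :> nat then (s, b, Wait)
         else ((s', inord s.2.-1), b', a)
       else ((s', s.2), b', a)).

Definition state (s : option task) (f : 'I_F.+1) : memory ring_search := (s, f).

Lemma brain_out x y d l e b : d <= n -> l <= n ->
  brain (walk x y true d l) e b = walk_out x y d l (odflt true e) b.
Proof. by move=> hd hl; rewrite /brain /walk !inordK. Qed.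

Lemma brain_in x y d l e b : d <= n -> l <= n ->
  brain (walk x y false d l) e b = walk_in x y d l (odflt true e) b.
Proof. by move=> hd hl; rewrite /brain /walk !inordK. Qed.

Lemma brain_test x d r e b : d <= n -> r <= m.*2.+1 ->
  brain (test x d r) e b = test_step x d r (odflt true e) b.
Proof. by move=> hd hr; rewrite /brain /test !inordK. Qed.

Variables (k : nat) (N : network n).
Implicit Types (c : config n k ring_search) (i : 'I_k) (f : 'I_F.+1).

Lemma step_go c i b s f v e s' b' x :
  agents c i = At (state s f) v e -> brain s e (boards c v) = (s', b', Go x) ->
  0 < f ->
  step N c i b = Config (upd (boards c) v b')
    (upd (agents c) i (Transit (state s' (inord f.-1)) v (x == cw_port N v)))
    (moves c).+1.
Proof. by rewrite /step => -> /= -> /=; case: eqP => // ->. Qed.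

Lemma step_wait c i b s f v e s' b' :
  agents c i = At (state s f) v e -> brain s e (boards c v) = (s', b', Wait) ->
  step N c i b = Config (upd (boards c) v b')
    (upd (agents c) i (At (state s' f) v e)) (moves c).
Proof. by rewrite /step => -> /= -> /=. Qed.

Lemma step_report c i b s f v e s' b' x d :
  agents c i = At (state s f) v e -> brain s e (boards c v) = (s', b', Report x d) ->
  step N c i b = Config (upd (boards c) v b')
    (upd (agents c) i (Reported x d)) (moves c).
Proof. by rewrite /step => -> /= -> /=. Qed.

Definition fuel (a : agent n ring_search) : nat :=
  match a with At s _ _ | Transit s _ _ => val s.2 | _ => 0 end.

(** A departure trades one unit of fuel for one move, and death or a report forfeits the rest. No
    invariant is assumed, so this covers the executions in which the hole has been declared safe. *)
Lemma step_fuel c i b :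
  moves (step N c i b) + \sum_j fuel (agents (step N c i b) j) <=
  moves c + \sum_j fuel (agents c j).
Proof.
suff [a [hb hf]] : exists a, agents (step N c i b) = upd (agents c) i a /\
    (moves (step N c i b) + fuel a <= moves c + fuel (agents c i)).
  rewrite hb (bigD1 i) //= [X in _ <= _ + X](bigD1 i) //= ffunE eqxx.
  rewrite !addnA leq_add // leq_sum // => j /negbTE ji.
  by rewrite ffunE ji.
have upd_id : agents c = upd (agents c) i (agents c i).
  by apply/ffunP => j; rewrite ffunE; case: eqP => // ->.
rewrite /step; case E: (agents c i) => [[s f] v e|[s f] v cw||y d].
- rewrite /=; case: (brain _ _ _) => [[s' b'] []] /=.
  + by eexists; split=> //.
  + move=> x; case: eqP => [f0|/eqP f0] /=.
      by eexists; split.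
    eexists; split=> //=.
    by rewrite inordK; have := ltn_ord f; lia.
  + by move=> x d; eexists; split=> //=; lia.
- case: ifP => _; eexists; split=> //=; lia.
- by exists Killed; rewrite -E.
- by exists (Reported y d); rewrite -E.
Qed.

Lemma moves_le (S : scheduler k) w : moves (run N ring_search S w) <= k * F.
Proof.
suff: moves (run N ring_search S w)
    + \sum_j fuel (agents (run N ring_search S w) j) <= k * F by lia.
elim: w => [|b w IH] /=; last exact: leq_trans (step_fuel _ _ _) IH.
rewrite add0n (eq_bigr (fun=> F)) ?sum_nat_const ?card_ord // => j _.
by rewrite ffunE.
Qed.

End Protocol.

(** * The ring seen from the homebase *)

Section Geometry.
Variables (n : nat) (N : network n).
Hypothesis hn : 2 < n.

(* The direction, clockwise or not, of an agent on side [y] that moves outwards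
   ([o = true]) or inwards. *)
Definition heading (y o : bool) : bool := o == (y == cw_port N (home N)).

Lemma headingE y o : heading y o = (o == (y == cw_port N (home N))).
Proof. by []. Qed.

Lemma site_out y d : neighbour (site N y d) (heading y true) = site N y d.+1.
Proof. by []. Qed.

Lemma neighbourK (v : 'I_n) cw : neighbour (neighbour v cw) (~~ cw) = v.
Proof. by case: cw => /=; rewrite ?ordSK ?ord_predK. Qed.

Lemma site_in y d : neighbour (site N y d.+1) (heading y false) = site N y d.
Proof.
have -> : heading y false = ~~ heading y true by rewrite /heading; case: (y == _).
by rewrite -site_out neighbourK.
Qed.

Lemma val_site y d : d <= n ->
  val (site N y d) = (home N + (if heading y true then d else n - d)) %% n.
Proof.
elim: d => [|d IH] hd.
  by rewrite subn0 /=; case: ifP; rewrite ?addn0 ?modnDr modn_small.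
rewrite -site_out /neighbour.
have := IH (ltnW hd); case: ifP => _ /= ->.
  by rewrite -addn1 modnDml addn1 addnS.
have -> : ((home N + (n - d)) %% n + n).-1 = (home N + (n - d)) %% n + n.-1 by lia.
rewrite modnDml.
have -> : home N + (n - d) + n.-1 = (home N + (n - d.+1)) + n by lia.
by rewrite modnDr.
Qed.

Lemma site_inj y d d' : d < n -> d' < n -> site N y d = site N y d' -> d = d'.
Proof.
move=> hd hd' /(congr1 val); rewrite !val_site; [|lia|lia].
case: ifP => _ /eqP; rewrite eqn_modDl.
  by rewrite !modn_small // => /eqP.
case: d hd => [|d] hd; case: d' hd' => [|d'] hd' //.
- by rewrite subn0 modnn modn_small; lia.
- by rewrite subn0 modnn modn_small; lia.
- by rewrite !modn_small; lia.
Qed.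

Definition dist (y : bool) : nat :=
  let d := (hole N + (n - home N)) %% n in if heading y true then d else n - d.

Hypothesis hole_home : hole N != home N.

Lemma dist_bounds y : 0 < dist y < n.
Proof.
rewrite /dist; set d := _ %% n.
have dn : d < n by rewrite ltn_mod; lia.
suff: d != 0 by case: ifP; lia.
rewrite /d; apply: contra hole_home => /eqP h; apply/eqP/val_inj => /=.
have /= := congr1 (fun t => (t + home N) %% n) h.
rewrite modnDml -addnA subnK ?add0n; last exact: ltnW.
by rewrite modnDr !modn_small.
Qed.

Lemma dist_sum y : dist y + dist (~~ y) = n.
Proof.
have dn : (hole N + (n - home N)) %% n <= n by rewrite ltnW // ltn_mod; lia.
by rewrite /dist /heading; case: y; case: (cw_port _ _) => /=; lia.
Qed.

Lemma site_dist y : site N y (dist y) = hole N.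
Proof.
apply/val_inj; rewrite val_site; last by have := dist_bounds y; lia.
have dn : (hole N + (n - home N)) %% n <= n by rewrite ltnW // ltn_mod; lia.
by rewrite /dist; case: (heading y true); rewrite ?subKn // modnDmr addnCA
  subnKC ?modnDr ?modn_small // ltnW.
Qed.

Lemma site_hole y d : d < n -> (site N y d == hole N) = (d == dist y).
Proof.
move=> hd; apply/eqP/eqP => [|->]; last exact: site_dist.
by rewrite -(site_dist y) => /site_inj; apply=> //; have := dist_bounds y; lia.
Qed.

End Geometry.

(* König's lemma for binary trees; it makes the time of termination uniform in
   the coins. *)
Lemma compactness (Q : pred (seq bool)) :
  (forall b w, Q w -> Q (b :: w)) ->
  (forall w : nat -> bool, exists t, Q (rev (mkseq w t))) ->
  exists T, forall w, T <= size w -> Q w.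
Proof.
move=> Qc Qi.
have Qcat u w : Q w -> Q (u ++ w) by elim: u => //= b u IH /IH /Qc.
pose deep w := forall T, exists2 u, T <= size u & ~~ Q (u ++ w).
have [d0|nd] := pselect (deep [::]); last first.
  have /existsNP[T hT] := nd; exists T => w sw.
  by apply/negPn/negP => nq; apply: hT; exists w => //; rewrite cats0.
have next w : exists b, deep w -> deep (b :: w).
  have [dw|ndw] := pselect (deep w); last by exists true => /ndw.
  have [dt|/existsNP[T1 h1]] := pselect (deep (true :: w)); first by exists true.
  exists false => _; move=> T.
  (* The last letter of [u] is the coin flipped right after [w]; beyond [T1] it cannot be [true]. *)
  have [u] := dw (maxn T T1).+1; case: (lastP u) => // u' b.
  rewrite size_rcons ltnS geq_max => /andP[s1 s2]; rewrite cat_rcons => nq.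
  case: b nq => nq; first by case: h1; exists u'.
  by exists u'.
have [f hf] := choice next.
pose W := fix W t := if t is t'.+1 then f (W t') :: W t' else [::].
have dW t : deep (W t) by elim: t => //= t /hf.
have [t qt] := Qi (fun t => f (W t)).
have WE k : rev (mkseq (fun t => f (W t)) k) = W k.
  by elim: k => //= k IH; rewrite mkseqS rev_rcons IH.
have [u _ /negP[]] := dW t 0.
by apply: Qcat; rewrite -WE.
Qed.

(** * Expectations over coin sequences *)

Section Probability.
Local Open Scope ring_scope.
Variables (R : realType) (q : R).
Hypothesis hq : 0 <= q <= 1.

Definition expectation (t : nat) (g : seq bool -> R) : R :=
  \sum_(w : t.-tuple bool) (\prod_(b <- w) (if b then q else 1 - q)) * g w.

(** The head of a word is its latest coin, so this averages over the last action given the whole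
    past. *)
Lemma expectation_cons t g : expectation t.+1 g =
  expectation t (fun w => q * g (true :: w) + (1 - q) * g (false :: w)).
Proof.
rewrite /expectation (reindex (fun u : bool * t.-tuple bool => [tuple of u.1 :: u.2])) /=.
  rewrite -(pair_bigA _ (fun b (w : t.-tuple bool) =>
    \prod_(a <- b :: w) (if a then q else 1 - q) * g (b :: w))) /=.
  rewrite big_bool /= -big_split /=; apply: eq_bigr => w _.
  by rewrite !big_cons; ring.
exists (fun w => (thead w, [tuple of behead w])) => [[b w] _|w _] /=.
  by congr pair; apply/val_inj.
by rewrite -tuple_eta.
Qed.

Lemma expectation_le t g g' : (forall w, size w = t -> g w <= g' w) ->
  expectation t g <= expectation t g'.
Proof.
move=> h; apply: ler_sum => w _; apply: ler_wpM2l; last by rewrite h ?size_tuple.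
by apply: prodr_ge0 => b _; case: b; case/andP: hq => q0 q1; rewrite ?subr_ge0.
Qed.

(** The mean of [g] cannot decrease with time. Since [g] sees the whole past, an adaptive scheduler
    needs no separate treatment. *)
Lemma submartingale_le_prob t (E : pred (seq bool)) g :
  (forall w, g w <= q * g (true :: w) + (1 - q) * g (false :: w)) ->
  (forall w, size w = t -> g w <= (E w)%:R) -> g [::] <= prob q t E.
Proof.
move=> hg hE; apply: (@le_trans _ _ (expectation t g)).
  elim: t {hE} => [|t IH].
    rewrite /expectation (big_pred1 [tuple]) /= ?big_nil ?mul1r // => w.
    by rewrite (tuple0 w); apply/esym/eqP.
  apply: le_trans IH _; rewrite expectation_cons.
  exact: expectation_le.
apply: le_trans (expectation_le hE) _.
rewrite /prob /expectation [leRHS]big_mkcond /=; apply: ler_sum => w _.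
by case: (E w); rewrite ?mulr1 ?mulr0.
Qed.

End Probability.

(** * Choice of the number of round trips *)

Section PowerDecay.
Local Open Scope ring_scope.
Variables (R : realType) (p : R).

(** Bernoulli's inequality in product form, which yields an explicit exponent without logarithms. *)
Lemma bernoulli_inv k : 0 <= p <= 1 -> (1 - p) ^+ k * (1 + k%:R * p) <= 1.
Proof.
move=> /andP[p0 p1]; elim: k => [|k IH]; first by rewrite mul0r addr0 mulr1.
apply: le_trans IH; rewrite exprSr -mulrA ler_wpM2l ?exprn_ge0 ?subr_ge0 //.
rewrite -natr1 -subr_ge0.
have -> : 1 + k%:R * p - (1 - p) * (1 + (k%:R + 1) * p) = (k%:R + 1) * p ^+ 2 by ring.
by rewrite mulr_ge0 ?sqr_ge0 // addr_ge0.
Qed.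

Lemma small_power (delta : R) : 0 < p <= 1 -> 0 < delta ->
  exists m : nat, (1 - p) ^+ m.*2.+2 *+ 2 <= delta.
Proof.
move=> /andP[p0 p1] d0.
(* With z = (1-p)^m, the bound z(1 + mp) <= 1 and mp > 2/delta give 2z <= delta; the exponent 2m+2
   only helps. *)
have [m hm] : exists m : nat, 2 / (delta * p) < m%:R.
  exists (Num.bound (2 / (delta * p))); apply: archi_boundP.
  by rewrite divr_ge0 // mulr_ge0 // ltW.
exists m; have := @bernoulli_inv m; rewrite (ltW p0) p1 => /(_ isT) hb.
have le : (1 - p) ^+ m.*2.+2 <= (1 - p) ^+ m.
  by apply: ler_wiXn2l; rewrite ?subr_ge0 ?gerBl ?(ltW p0) //; lia.
rewrite -mulr_natr; apply: le_trans (ler_wpM2r _ le) _ => //.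
have z0 : 0 <= (1 - p) ^+ m by rewrite exprn_ge0 // subr_ge0.
move: hm; rewrite ltr_pdivrMr ?mulr_gt0 // => hm.
set z := (1 - p) ^+ m in hb z0 *; set M : R := m%:R in hm hb.
have : z * 2 <= z * (M * (delta * p)) by rewrite ler_wpM2l // ltW.
have : delta * (z * (1 + M * p)) <= delta * 1 by rewrite ler_wpM2l // ltW.
have : 0 <= delta * z by rewrite mulr_ge0 // ltW.
by lra.
Qed.

End PowerDecay.
(** * Invariant of the executions in which the hole is not declared safe *)

Section Invariant.
Variables (n m F : nat) (N : network n).
Hypothesis hn : 2 < n.
Hypothesis hole_home : hole N != home N.

Local Notation P := (ring_search n m F).
Local Notation conf := (config n 2 P).
Implicit Types (c : conf) (fr lim msg : bool -> nat) (x y o : bool).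
Implicit Types (s : memory P) (a : agent n P) (B : {ffun 'I_n -> whiteboard n}).
Local Notation dist := (dist N).
Local Notation site := (site N).
Local Notation heading := (heading N).

Definition prev (d : nat) (o : bool) : nat := if o then d.-1 else d.+1.

(* The agent is at [site y d] or on its last link to it. The entry port is
   irrelevant to an agent that leaves the homebase outwards. *)
Inductive located s y d o : agent n P -> Prop :=
| LocAt e : (o && (d == 0)) ||
      (e == Some (~~ (heading y o == cw_port N (site y d)))) ->
    located s y d o (At s (site y d) e)
| LocTransit : (o ==> (0 < d)) ->
    located s y d o (Transit s (site y (prev d o)) (heading y o)).

Lemma arrive y d o : (o ==> (0 < d)) ->
  neighbour (site y (prev d o)) (heading y o) = site y d.
Proof.
case: o => /= [|_]; last exact: site_in.
by case: d => // d _; exact: site_out.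
Qed.

Lemma step_transit c i b s y d o :
  agents c i = Transit s (site y (prev d o)) (heading y o) ->
  (o ==> (0 < d)) -> d < n -> prev d o < n ->
  step N c i b = Config (boards c) (upd (agents c) i
    (if ((prev d o == dist y) || (d == dist y)) && b then Killed
     else At s (site y d)
            (Some (~~ (heading y o == cw_port N (site y d)))))) (moves c).
Proof.
move=> E od hd hp; rewrite /step E arrive // !site_hole //.
by case: (heading y o); rewrite ?eqbF_neg ?negbK.
Qed.

Lemma back_port y d o e :
  e == Some (~~ (heading y o == cw_port N (site y d))) ->
  (odflt true e == cw_port N (site y d)) = heading y (~~ o) /\
  (~~ odflt true e == cw_port N (site y d)) = heading y o.
Proof.
move=> /eqP -> /=; rewrite !headingE.
by case: (y == _); case: (cw_port _ _); case: o.
Qed.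

Lemma forward_port y d e :
  (d == 0) || (e == Some (~~ (heading y true == cw_port N (site y d)))) ->
  ((if d == 0 then y else ~~ odflt true e) == cw_port N (site y d)) =
  heading y true.
Proof.
by case: eqP => [-> _|_ /back_port[_ ->]] //=; rewrite headingE; case: (y == _).
Qed.

(* [fr x] is the number of nodes declared safe on side [x], [lim x] the limit of
   its explorer, and [msg x] the limit written at the frontier [site x (fr x)],
   which prevails over the one in memory. [level] bounds the number of divisions
   to come and [need] the number of moves. *)
Definition level fr lim : nat :=
  up_log 2 (maxn (lim true - fr true) (lim false - fr false)).

Definition need fr lim x (v : nat) : nat :=
  4 * n * (level fr lim + v) + (m.*2 + 3) * (n - fr x).

(** A trip to the companion has four legs of at most [n] links: in from the own frontier, out to the
    other one, and both again to return. In [need], [v = 1] pays for the final trip, which ends in a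
    report; [OkLeave] and [OkVisit] take [v = 0] because they count the remaining legs of the
    current trip explicitly. A node costs [m.*2 + 2] traversals for its test and one more to advance
    to it. *)
Inductive agent_ok x fr lim msg : agent n P -> Prop :=
| OkStart : x = false -> fr x = 0 ->
    (msg x = 0 -> lim x = uphalf n.-1) ->
    n + need fr lim x 1 <= F ->
    agent_ok x fr lim msg (At (state None ord_max) (home N) None)
| OkExplore d l (f : 'I_F.+1) a :
    located (state (walk n m x x true d l) f) x d true a ->
    d <= fr x -> l <= n -> (msg x = 0 -> l = lim x) ->
    n - d + need fr lim x 1 <= f ->
    agent_ok x fr lim msg a
| OkLeave d (f : 'I_F.+1) a :
    located (state (walk n m x x false d (lim x)) f) x d false a ->
    d < fr x -> msg x = 0 -> lim x = fr x ->
    3 * n + d + need fr lim x 0 <= f ->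
    agent_ok x fr lim msg a
| OkVisit d (f : 'I_F.+1) a :
    located (state (walk n m x (~~ x) true d (lim x)) f) (~~ x) d true a ->
    d <= fr (~~ x) -> msg x = 0 -> lim x = fr x ->
    2 * n + (n - d) + need fr lim x 0 <= f ->
    agent_ok x fr lim msg a
| OkReturn d l (f : 'I_F.+1) a :
    located (state (walk n m x (~~ x) false d l) f) (~~ x) d false a ->
    d < fr (~~ x) -> l <= n -> (msg x = 0 -> l = lim x) ->
    n + d + need fr lim x 1 <= f ->
    agent_ok x fr lim msg a
| OkTest r (f : 'I_F.+1) a :
    located (state (test n m x (fr x) r) f) x (fr x + odd r) (odd r) a ->
    r <= m.*2.+1 -> msg x != 0 ->
    r + (n - fr x) + need fr lim x 1 <= f + m.*2 + 2 ->
    agent_ok x fr lim msg a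
| OkKilled : msg x != 0 -> (fr x).+1 = dist x -> agent_ok x fr lim msg Killed
| OkReported : agent_ok x fr lim msg (Reported (~~ x) (dist (~~ x))).

(** What the companion may do meanwhile: advance its own frontier, or leave a new limit here. The
    latter happens only while this share is unfinished, which excludes [OkLeave] and [OkVisit]. *)
Lemma agent_ok_frame x fr lim msg fr' lim' msg' a :
  agent_ok x fr lim msg a -> fr' x = fr x -> fr (~~ x) <= fr' (~~ x) ->
  level fr' lim' <= level fr lim ->
  (msg' x = msg x /\ lim' x = lim x) \/ (msg' x != 0 /\ fr x < lim x) ->
  agent_ok x fr' lim' msg' a.
Proof.
move=> H efr lefr hlev hm.
have hneed v : need fr' lim' x v <= need fr lim x v.
  by rewrite /need efr leq_add2r leq_mul2l leq_add2r hlev orbT.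
have hl : msg' x = 0 -> msg x = 0 /\ lim' x = lim x.
  by case: hm => [[-> ->]|[/eqP]].
have hm0 : msg x = 0 -> lim x = fr x -> msg' x = 0 /\ lim' x = lim x.
  by case: hm => [[-> ->]|[_]] //; lia.
have hmn : msg x != 0 -> msg' x != 0 by case: hm => [[-> _]|[]].
case: H => [x0 fr0 h1 h2|d l f b L hd hl' h1 h2|d f b L hd h0 h1 h2
  |d f b L hd h0 h1 h2|d l f b L hd hl' h1 h2|r f b L hr h1 h2|h1 h2|].
- apply: OkStart; rewrite ?efr //; first by move=> /hl[/h1 <- ->].
  by apply: leq_trans h2; rewrite leq_add2l.
- apply: (OkExplore L); rewrite ?efr //; first by move=> /hl[/h1 -> ->].
  by apply: leq_trans h2; rewrite leq_add2l.
- have [m0 l0] := hm0 h0 h1; rewrite -l0 in L h1.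
  apply: (OkLeave L); rewrite ?efr //.
  by apply: leq_trans h2; rewrite leq_add2l.
- have [m0 l0] := hm0 h0 h1; rewrite -l0 in L h1.
  apply: (OkVisit L); rewrite ?efr //; first exact: leq_trans lefr.
  by apply: leq_trans h2; rewrite leq_add2l.
- apply: (OkReturn L); rewrite ?efr //; first exact: leq_trans lefr.
    by move=> /hl[/h1 -> ->].
  by apply: leq_trans h2; rewrite leq_add2l.
- rewrite -efr in L h2; apply: (OkTest L); rewrite ?hmn //.
  by apply: leq_trans h2; rewrite leq_add2l.
- by apply: OkKilled; rewrite ?hmn ?efr.
- exact: OkReported.
Qed.

Definition other x (T : Type) (u : T) (g : bool -> T) : bool -> T :=
  fun z => if z == x then u else g z.

(** The two shares partition the nodes other than the homebase, so exactly one contains the hole. *)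
Record ghost_ok fr lim msg : Prop := GhostOk {
  ghost_fr : forall x, fr x < dist x;
  ghost_lim : forall x, (0 < lim x) && (fr x <= lim x);
  ghost_sum : forall x, lim x + lim (~~ x) = n.-1;
  ghost_msg : forall x, msg x != 0 -> msg x = lim x /\ fr x < lim x }.

(** Limits behind the frontier are left unspecified: a marked slot makes the walker pass on without
    using them. *)
Record boards_ok B fr msg : Prop := BoardsOk {
  boards_mark : forall x d, d < n -> ((B (site x d)).2 x).1 = (d < fr x);
  boards_msg : forall x d, fr x <= d < n ->
    val ((B (site x d)).2 x).2 = if d == fr x then msg x else 0;
  boards_flag : (B (home N)).1 }.

(* [i0] is the first agent to act, hence to register. *)
Definition agent_of (i0 : 'I_2) x : 'I_2 := if x then i0 else rev_ord i0.

Lemma agent_of_inj i0 : injective (agent_of i0).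
Proof. by move: i0; case=> [[|[|]]] //= ? [] [] // /(congr1 val). Qed.

Lemma agent_of_surj i0 i : exists x, i = agent_of i0 x.
Proof.
case: i0 i => [[|[|]]] //= h [[|[|]]] //= h';
  by [exists true; apply/val_inj | exists false; apply/val_inj].
Qed.

Record inv i0 c fr lim msg : Prop := Inv {
  inv_ghost : ghost_ok fr lim msg;
  inv_boards : boards_ok (boards c) fr msg;
  inv_agents : forall x, agent_ok x fr lim msg (agents c (agent_of i0 x)) }.

Lemma inv_update i0 c x fr lim msg fr' lim' msg' B a mv :
  inv i0 c fr lim msg -> ghost_ok fr' lim' msg' -> boards_ok B fr' msg' ->
  agent_ok x fr' lim' msg' a ->
  fr' (~~ x) = fr (~~ x) -> fr x <= fr' x -> level fr' lim' <= level fr lim ->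
  (msg' (~~ x) = msg (~~ x) /\ lim' (~~ x) = lim (~~ x)) \/
  (msg' (~~ x) != 0 /\ fr (~~ x) < lim (~~ x)) ->
  inv i0 (@Config n 2 P B (upd (agents c) (agent_of i0 x) a) mv) fr' lim' msg'.
Proof.
move=> [G Bo A] G' B' Ha e1 e2 e3 e4; split=> // z.
rewrite ffunE (inj_eq (@agent_of_inj _)); case: eqP => [-> //|/eqP zx].
have ez : z = ~~ x by move: zx; case: z x {Ha e1 e2 e4} => [] [].
by subst z; apply: (agent_ok_frame (A (~~ x))); rewrite // ?negbK.
Qed.

Lemma upd_id (I : finType) (T : Type) (g : {ffun I -> T}) i : upd g i (g i) = g.
Proof. by apply/ffunP => j; rewrite ffunE; case: eqP => // ->. Qed.

Lemma inv_agent i0 c x fr lim msg a mv :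
  inv i0 c fr lim msg -> agent_ok x fr lim msg a ->
  inv i0 (@Config n 2 P (boards c) (upd (agents c) (agent_of i0 x) a) mv) fr lim msg.
Proof. by move=> H Ha; case: (H) => G B A; apply: (inv_update _ H); auto. Qed.

(** Every node has a name on each side. Separate slots per side keep the two namings from
    interfering, and on one side a node has a single name below [n]. *)
Lemma write_slot B y d mk l x d' : d < n -> d' < n -> l <= n ->
  (upd B (site y d) (write (B (site y d)) y mk l) (site x d')).2 x =
  if (x == y) && (d' == d) then (mk, inord l) else (B (site x d')).2 x.
Proof.
move=> hd hd' hl; rewrite ffunE; case: (x =P y) => [->|/eqP /negbTE xy] /=.
  case: (d' =P d) => [->|dd']; first by rewrite eqxx ffunE eqxx.
  by case: eqP => // /(site_inj hn hd' hd).
by case: eqP => // <-; rewrite ffunE xy.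
Qed.

Lemma write_flag B v y mk l w : (upd B v (write (B v) y mk l) w).1 = (B w).1.
Proof. by rewrite ffunE; case: eqP => // ->. Qed.

Lemma write_msg_ok B fr msg y l : boards_ok B fr msg -> fr y < n -> l <= n ->
  boards_ok (upd B (site y (fr y)) (write (B (site y (fr y))) y false l)) fr
    (other y l msg).
Proof.
move=> [B1 B2 B3] hf hl; split=> [x d hd|x d /andP[h1 h2]|].
- rewrite write_slot //; case: ifP; last by rewrite B1.
  by move=> /andP[/eqP -> /eqP ->]; rewrite ltnn.
- rewrite write_slot // /other; case: (x =P y) h1 => [->|_] h1 /=; last first.
    by rewrite B2 ?h1.
  case: ifP => [_|df] /=; first by rewrite inordK.
  by have := B2 y d; rewrite h1 h2 df; apply.
- by rewrite write_flag.
Qed.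

Lemma mark_ok B fr msg y : boards_ok B fr msg -> (fr y).+1 < n ->
  boards_ok (upd B (site y (fr y)) (write (B (site y (fr y))) y true 0))
    (other y (fr y).+1 fr) (other y 0 msg).
Proof.
move=> [B1 B2 B3] hf; split=> [x d hd|x d|].
- rewrite write_slot //; last exact: ltnW.
  rewrite /other; case: (x =P y) => [->|_] /=; last by rewrite B1.
  by case: eqP => [-> //=|]; rewrite ?B1 // 1?ltnS; lia.
- rewrite /other; case: (eqVneq x y) => [->|xy] /andP[h1 h2] /=.
    rewrite write_slot // ?eqxx; try lia.
    have /negbTE -> /= : d != fr y by lia.
    by rewrite B2 ?if_same; [case: ifP => //; lia|lia].
  by rewrite write_slot // ?(negbTE xy) ?B2 ?h1 // ltnW.
- by rewrite write_flag.
Qed.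

(* Traversals of a link of the hole left before the hole is declared safe. *)
Definition crossings (t : option (task n m)) (moving : bool) : nat :=
  if t is Some (inr (x, d, r)) then
    if d.+1 == dist x then r + moving else m.*2.+2
  else m.*2.+2.

Lemma crossings_test x d r t : d <= n -> r <= m.*2.+1 ->
  crossings (test n m x d r) t = if d.+1 == dist x then r + t else m.*2.+2.
Proof. by move=> hd hr; rewrite /crossings /test !inordK. Qed.

Definition dead a : bool :=
  match a with Killed | Reported _ _ => true | _ => false end.

Definition left a : nat :=
  match a with
  | At s _ _ => crossings s.1 false
  | Transit s _ _ => crossings s.1 true
  | _ => 0
  end.

(** Tasks are ordered so that each switch made without moving goes down. Values from 1 to 3 fit
    below the factor 4 of [rank], so departures and arrivals decrease it too. *)
Definition rank_task (t : option (task n m)) : nat :=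
  match t with
  | None => 2
  | Some (inl (x, y, o, _, _)) => if ~~ o then 3 else if y == x then 1 else 2
  | Some (inr _) => 1
  end.

Definition rank a : nat :=
  match a with
  | At s _ _ => 4 * val s.2 + rank_task s.1
  | Transit s _ _ => 4 * val s.2 + 4
  | _ => 0
  end.

(* The hole has been declared safe. *)
Definition marked B : bool := [exists x, ((B (site x (dist x).-1)).2 x).1].

(* Effect of an action on the acting agent, as a function of the coin. *)
Inductive move_spec a : (bool -> agent n P) -> Prop :=
| Sure a' : dead a' || (left a <= left a') -> rank a' < rank a ->
    move_spec a (fun=> a')
| Risky a' : left a = (left a').+1 -> rank a' < rank a ->
    move_spec a (fun b => if b then Killed else a').

(** Marking the hole is allowed only to an agent with [left] equal to 0: its weight is then 1, which
    already pays for the failure. *)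
Definition step_ok i0 c x : Prop :=
  exists2 A : bool -> agent n P,
    move_spec (agents c (agent_of i0 x)) A &
    forall b, agents (step N c (agent_of i0 x) b) =
        upd (agents c) (agent_of i0 x) (A b) /\
      ((exists fr lim msg, inv i0 (step N c (agent_of i0 x) b) fr lim msg) \/
       (marked (boards (step N c (agent_of i0 x) b)) /\
        left (agents c (agent_of i0 x)) = 0)).

Lemma rank_task_bounds t : 0 < rank_task t <= 3.
Proof. by case: t => [[[[[[x y] []] d] l]|]|] //=; case: ifP. Qed.

Lemma negb_eq x : (~~ x == x) = false.
Proof. by case: x. Qed.

Lemma sure_ok i0 c x B a' mv :
  (forall b, step N c (agent_of i0 x) b =
     @Config n 2 P B (upd (agents c) (agent_of i0 x) a') mv) ->
  dead a' || (left (agents c (agent_of i0 x)) <= left a') ->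
  rank a' < rank (agents c (agent_of i0 x)) ->
  (exists fr lim msg,
     inv i0 (@Config n 2 P B (upd (agents c) (agent_of i0 x) a') mv) fr lim msg) \/
  (marked B /\ left (agents c (agent_of i0 x)) = 0) ->
  step_ok i0 c x.
Proof.
move=> E h1 h2 h3; exists (fun=> a'); first exact: Sure.
by move=> b; rewrite !E; split.
Qed.

Lemma go_ok i0 c x t (f : 'I_F.+1) v e t' b' p :
  agents c (agent_of i0 x) = At (state t f) v e ->
  brain t e (boards c v) = (t', b', Go p) -> 0 < f ->
  crossings t false <= crossings t' true ->
  (forall f' : 'I_F.+1, f' = f.-1 :> nat ->
     (exists fr lim msg,
       inv i0 (@Config n 2 P (upd (boards c) v b')
         (upd (agents c) (agent_of i0 x)
            (Transit (state t' f') v (p == cw_port N v))) (moves c).+1) fr lim msg) \/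
     (marked (upd (boards c) v b') /\ crossings t false = 0)) ->
  step_ok i0 c x.
Proof.
move=> E Eb f0 hc hi.
have ff : (inord f.-1 : 'I_F.+1) = f.-1 :> nat.
  by rewrite inordK //; have := ltn_ord f; rewrite ltnS; lia.
apply: (sure_ok (fun b => step_go N b E Eb f0)).
- by rewrite E.
- rewrite E /= ff; have := rank_task_bounds t. lia.
- by rewrite E; apply: hi.
Qed.

Lemma wait_ok i0 c x t (f : 'I_F.+1) v e t' b' :
  agents c (agent_of i0 x) = At (state t f) v e ->
  brain t e (boards c v) = (t', b', Wait) ->
  crossings t false <= crossings t' false -> rank_task t' < rank_task t ->
  (exists fr lim msg,
       inv i0 (@Config n 2 P (upd (boards c) v b')
         (upd (agents c) (agent_of i0 x) (At (state t' f) v e)) (moves c)) fr lim msg) ->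
  step_ok i0 c x.
Proof.
move=> E Eb hc hr hi.
apply: (sure_ok (fun b => step_wait N b E Eb)).
- by rewrite E.
- by rewrite E /= ltn_add2l.
- by left.
Qed.

Lemma arrive_ok i0 c x fr lim msg s y d o :
  inv i0 c fr lim msg ->
  agents c (agent_of i0 x) = Transit s (site y (prev d o)) (heading y o) ->
  (o ==> (0 < d)) -> d < n -> prev d o < n ->
  d != dist y -> prev d o != dist y ->
  crossings s.1 true <= crossings s.1 false ->
  (forall a, located s y d o a -> agent_ok x fr lim msg a) ->
  step_ok i0 c x.
Proof.
move=> H E od hd hp nd np hc ok.
apply: (@sure_ok _ _ _ (boards c)
  (At s (site y d) (Some (~~ (heading y o == cw_port N (site y d))))) (moves c)).
- by move=> b; rewrite (step_transit b E) // (negbTE nd) (negbTE np).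
- by rewrite E.
- by rewrite E ltn_add2l ltnS; case/andP: (rank_task_bounds s.1).
- left; exists fr, lim, msg; apply: inv_agent => //; apply: ok.
  by apply: LocAt; rewrite eqxx orbT.
Qed.

Lemma level_le fr lim fr' lim' :
  (forall x, lim' x - fr' x <= maxn (lim true - fr true) (lim false - fr false)) ->
  level fr' lim' <= level fr lim.
Proof. by move=> h; apply: leq_up_log; rewrite geq_max !h. Qed.

(** With one share exhausted, the maximum in [level] is the other share, and replacing it by its
    upper half lowers [up_log 2] by one. *)
Lemma level_halve fr lim fr' lim' x :
  lim x <= fr x -> 1 < lim (~~ x) - fr (~~ x) ->
  (forall y, lim' y - fr' y <= uphalf (lim (~~ x) - fr (~~ x))) ->
  level fr' lim' < level fr lim.
Proof.
rewrite /level => h1 h2 h3.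
have -> : maxn (lim true - fr true) (lim false - fr false) = lim (~~ x) - fr (~~ x).
  have e : lim x - fr x = 0 by apply/eqP; rewrite subn_eq0.
  by case: x e {h1 h2 h3} => /= ->; rewrite ?max0n ?maxn0.
case: (lim (~~ x) - fr (~~ x)) h2 h3 => [|u] // u1 h3.
rewrite up_log2S // ltnS leq_up_log // geq_max.
by have := h3 true; have := h3 false; rewrite uphalfE /= => -> ->.
Qed.

(* The boolean hypotheses on ports and boards make [lia] very slow. *)
Ltac arith :=
  repeat match goal with
  | h : ?T |- _ =>
      lazymatch T with
      | is_true (leq _ _) => fail
      | is_true (leq _ _ && leq _ _) => fail
      | is_true (~~ (_ == _ :> nat)) => fail
      | @eq nat _ _ => fail
      | nat => fail
      | _ => clear h
      end
  end; lia.

(** * Effect of one action, phase by phase *)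

Section Step.
Variables (i0 : 'I_2) (c : conf) (fr lim msg : bool -> nat) (x : bool).
Hypothesis H : inv i0 c fr lim msg.
Local Notation i := (agent_of i0 x).

Lemma fr_lt y : fr y < n.
Proof. by have := ghost_fr (inv_ghost H) y; have := dist_bounds hn hole_home y; arith. Qed.

Lemma lim_lt y : lim y < n.
Proof. by have := ghost_sum (inv_ghost H) y; have := hn; arith. Qed.

Lemma home_safe y d : d <= fr y -> d != dist y.
Proof. by have := ghost_fr (inv_ghost H) y; arith. Qed.

Lemma start_step :
  agents c i = At (state None ord_max) (home N) None ->
  x = false -> fr x = 0 -> (msg x = 0 -> lim x = uphalf n.-1) ->
  n + need fr lim x 1 <= F -> step_ok i0 c x.
Proof.
move=> E x0 fr0 h1 h2.
have hb := boards_flag (inv_boards H).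
have bE : (true, (boards c (home N)).2) = boards c (home N) :> whiteboard n.
  by rewrite -hb; case: (boards c (home N)).
apply: (wait_ok E); first by rewrite /brain hb bE /=; reflexivity.
- by [].
- by [].
exists fr, lim, msg; rewrite upd_id; apply: inv_agent => //.
have -> : false = x by [].
apply: (@OkExplore _ _ _ _ 0 (uphalf n.-1) ord_max) => //.
- exact: (@LocAt (state (walk n m x x true 0 (uphalf n.-1)) ord_max) x 0 true None).
- by have := hn; arith.
- by move/h1.
- by rewrite subn0 /=.
Qed.

Lemma explore_step d l (f : 'I_F.+1) :
  located (state (walk n m x x true d l) f) x d true (agents c i) ->
  d <= fr x -> l <= n -> (msg x = 0 -> l = lim x) ->
  n - d + need fr lim x 1 <= f -> step_ok i0 c x.
Proof.
move Ea: (agents c i) => a L hd hl h1 h2.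
have [G Bo A] := H.
have frn := fr_lt x; have limn := lim_lt x.
have dn : d < n by exact: leq_ltn_trans frn.
have f0 : 0 < f by move: h2; rewrite /need; have := hn; arith.
case: L Ea => [e he|d0] E; last first.
  apply: (arrive_ok H E) => //=; rewrite ?home_safe //; try arith.
  by move=> a' La; apply: (OkExplore La).
have fp := forward_port he.
have bm := boards_mark Bo x dn.
have bb : brain (walk n m x x true d l) e (boards c (site x d)) = _ :=
  brain_out m x x e (boards c (site x d)) (ltnW dn) hl.
case: (ltnP d (fr x)) => dfr.
  apply: (go_ok E) => //; first by rewrite bb /walk_out bm dfr; reflexivity.
  - by [].
  move=> f' f'E; left; exists fr, lim, msg; rewrite upd_id; apply: inv_agent => //.
  rewrite fp; apply: (@OkExplore _ _ _ _ d.+1 l f') => //; last by arith.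
  exact: LocTransit.
have dE : d = fr x by arith.
subst d.
have mE : val ((boards c (site x (fr x))).2 x).2 = msg x.
  by rewrite (boards_msg Bo) ?leqnn //= eqxx.
(* A stale limit in memory is harmless, since a written limit prevails. *)
have hlim : (if msg x == 0 then l else msg x) = lim x.
  case: eqP => [/h1 //|/eqP m0]; by case: (ghost_msg G m0).
have /andP[lim0 frlim] := ghost_lim G x.
move: bb; rewrite /walk_out bm ltnn eqxx mE hlim => bb.
case: (ltnP (fr x) (lim x)) bb => flt bb.
  apply: (go_ok E bb) => //.
    by rewrite crossings_test ?(ltnW frn) // addn1 if_same.
  move=> f' f'E; left; exists fr, lim, (other x (lim x) msg).
  apply: (inv_update _ H) => //.
  - case: G => g1 g2 g3 g4; split=> // y; rewrite /other.
    by case: (y =P x) => [->|_]; [split | exact: g4].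
  - exact/write_msg_ok/ltnW.
  - rewrite fp; apply: (@OkTest _ _ _ _ m.*2.+1 f') => //.
    + have := @LocTransit (state (test n m x (fr x) m.*2.+1) f') x (fr x).+1 true isT.
      by rewrite /= odd_double addn1.
    + by rewrite /other eqxx -lt0n.
    + by move: h2; arith.
  - by left; rewrite /other negb_eq.
have limE : lim x = fr x by arith.
have msg0 : msg x = 0.
  by apply/eqP/negPn/negP => /(ghost_msg G)[_]; rewrite limE ltnn.
move: bb he; rewrite /turn.
case dE: (fr x) => [|d'] bb he; first by move: lim0; rewrite limE dE.
have [bp _] := back_port he.
rewrite dE in E.
apply: (go_ok E bb) => //.
move=> f' f'E; left; exists fr, lim, msg; rewrite upd_id; apply: inv_agent => //.
rewrite bp; apply: (@OkLeave _ _ _ _ d' f') => //; last 2 first.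
- by rewrite dE.
- by move: h2; rewrite /need dE; have := hn; arith.
exact: LocTransit.
Qed.

Lemma leave_step d (f : 'I_F.+1) :
  located (state (walk n m x x false d (lim x)) f) x d false (agents c i) ->
  d < fr x -> msg x = 0 -> lim x = fr x ->
  3 * n + d + need fr lim x 0 <= f -> step_ok i0 c x.
Proof.
move Ea: (agents c i) => a L hd h0 h1 h2.
have frn := fr_lt x; have limn := lim_lt x.
have dn : d < n by exact: ltn_trans frn.
have f0 : 0 < f by move: h2; have := hn; arith.
case: L Ea => [e he|d0] E; last first.
  apply: (arrive_ok H E) => //=; rewrite ?home_safe //; try arith.
  by move=> a' La; apply: (OkLeave La).
have [_ bp] := back_port he.
have bb : brain (walk n m x x false d (lim x)) e (boards c (site x d)) = _ :=
  brain_in m x x e (boards c (site x d)) (ltnW dn) (ltnW limn).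
move: bb bp E; rewrite /walk_in; case: d hd dn h2 he => [|d'] hd dn h2 he bb bp E.
  apply: (wait_ok E bb) => //; first by rewrite /= negb_eq.
  exists fr, lim, msg; rewrite upd_id; apply: inv_agent => //.
  apply: (@OkVisit _ _ _ _ 0 f) => //; last by move: h2; arith.
  exact: (@LocAt (state (walk n m x (~~ x) true 0 (lim x)) f) (~~ x) 0 true).
apply: (go_ok E bb) => //.
move=> f' f'E; left; exists fr, lim, msg; rewrite upd_id; apply: inv_agent => //.
rewrite bp; apply: (@OkLeave _ _ _ _ d' f') => //; last 2 first.
- by arith.
- by move: h2; arith.
exact: LocTransit.
Qed.

Lemma return_step d l (f : 'I_F.+1) :
  located (state (walk n m x (~~ x) false d l) f) (~~ x) d false (agents c i) ->
  d < fr (~~ x) -> l <= n -> (msg x = 0 -> l = lim x) ->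
  n + d + need fr lim x 1 <= f -> step_ok i0 c x.
Proof.
move Ea: (agents c i) => a L hd hl h1 h2.
have frn := fr_lt (~~ x).
have dn : d < n by exact: ltn_trans frn.
have f0 : 0 < f by move: h2; have := hn; arith.
case: L Ea => [e he|d0] E; last first.
  apply: (arrive_ok H E) => //=; rewrite ?home_safe //; try arith.
  by move=> a' La; apply: (OkReturn La).
have [_ bp] := back_port he.
have bb : brain (walk n m x (~~ x) false d l) e (boards c (site (~~ x) d)) = _ :=
  brain_in m x (~~ x) e (boards c (site (~~ x) d)) (ltnW dn) hl.
move: bb bp E; rewrite /walk_in; case: d hd dn h2 he => [|d'] hd dn h2 he bb bp E.
  rewrite negbK in bb.
  apply: (wait_ok E bb) => //; first by rewrite /= eqxx.
  exists fr, lim, msg; rewrite upd_id; apply: inv_agent => //.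
  apply: (@OkExplore _ _ _ _ 0 l f) => //; last by move: h2; arith.
  exact: (@LocAt (state (walk n m x x true 0 l) f) x 0 true).
apply: (go_ok E bb) => //.
move=> f' f'E; left; exists fr, lim, msg; rewrite upd_id; apply: inv_agent => //.
rewrite bp; apply: (@OkReturn _ _ _ _ d' l f') => //; last 2 first.
- by arith.
- by move: h2; arith.
exact: LocTransit.
Qed.

Lemma visit_step d (f : 'I_F.+1) :
  located (state (walk n m x (~~ x) true d (lim x)) f) (~~ x) d true (agents c i) ->
  d <= fr (~~ x) -> msg x = 0 -> lim x = fr x ->
  2 * n + (n - d) + need fr lim x 0 <= f -> step_ok i0 c x.
Proof.
move Ea: (agents c i) => a L hd h0 h1 h2.
have [G Bo A] := H.
set y := ~~ x in L hd *.
have frn := fr_lt y; have limn := lim_lt x; have limyn := lim_lt y.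
have dn : d < n by exact: leq_ltn_trans frn.
have f0 : 0 < f by move: h2; have := hn; arith.
case: L Ea => [e he|d0] E; last first.
  apply: (arrive_ok H E) => //=; rewrite ?home_safe //; try arith.
  by move=> a' La; apply: (OkVisit La).
have fp := forward_port he.
have bm := boards_mark Bo y dn.
have bb : brain (walk n m x y true d (lim x)) e (boards c (site y d)) = _ :=
  brain_out m x y e (boards c (site y d)) (ltnW dn) (ltnW limn).
case: (ltnP d (fr y)) => dfr.
  apply: (go_ok E) => //; first by rewrite bb /walk_out bm dfr; reflexivity.
  - by [].
  move=> f' f'E; left; exists fr, lim, msg; rewrite upd_id; apply: inv_agent => //.
  rewrite fp; apply: (@OkVisit _ _ _ _ d.+1 f') => //; last by arith.
  exact: LocTransit.
have dE : d = fr y by arith.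
subst d.
have /andP[limx0 frlimx] := ghost_lim G x.
have /andP[lim0 frlim] := ghost_lim G y.
have sm : lim x + lim y = n.-1 := ghost_sum G x.
have yx : (y == x) = false := negb_eq x.
have uE : n.-1 - fr y - lim x = lim y - fr y by arith.
move: bb; rewrite /walk_out bm ltnn yx uE.
set u := lim y - fr y.
case: (ltnP 1 u) => hu bb; last first.
  (* Both frontiers lie strictly before the hole and the two distances to it sum to [n], so a single
     unexplored node must be the hole. *)
  have dyE : (fr y).+1 = dist y.
    have := dist_sum hn hole_home x; have := ghost_fr G x; have := ghost_fr G y.
    by move: hu; rewrite /u -/y; arith.
  apply: (sure_ok (fun b => step_report N b E bb)); rewrite ?E //.
    rewrite /=; have := rank_task_bounds (walk n m x y true (fr y) (lim x)).
    by rewrite /=; arith.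
  left; exists fr, lim, msg; rewrite upd_id; apply: inv_agent => //.
  by rewrite dyE; exact: OkReported.
(* Only these facts about the halves matter: [0 < q] gives the finisher new work, and [0 < p] puts
   the companion's limit beyond its frontier. *)
have [p [q [hu12 hpq hq hlev]]] : exists p q, [/\ (uphalf u, u./2) = (p, q),
    p + q = u, 0 < q <= p & forall lim', (forall z, lim' z - fr z <= p) ->
    level fr lim' < level fr lim].
  exists (uphalf u), u./2; split=> //.
  - by rewrite uphalf_half -addnA addnn odd_double_half.
  - by rewrite uphalf_half leq_addl half_gt0 hu.
  - by move=> lim' h; apply: (@level_halve _ _ _ _ x); rewrite ?h1.
case: hu12 bb => -> -> bb.
have uE' : p + q = lim y - fr y by [].
clearbody u; clear hu hpq.
pose lim' := fun z => if z == x then lim x + q else fr y + p.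
pose msg' := other y (fr y + p) msg.
have l'x : lim' x = lim x + q by rewrite /lim' eqxx.
have l'y : lim' y = fr y + p by rewrite /lim' yx.
have m'x : msg' x = 0 by rewrite /msg' /other eq_sym yx.
have m'y : msg' y = fr y + p by rewrite /msg' /other eqxx.
clearbody lim'.
have zxy z : z = x \/ z = y by rewrite /y; case: (z) (x) => [] []; auto.
have lt : level fr lim' < level fr lim.
  by apply: hlev => z; case: (zxy z) => ->; arith.
have G' : ghost_ok fr lim' msg'.
  split; first exact: (ghost_fr G).
  - by move=> z; case: (zxy z) => ->; arith.
  - move=> z; suff: lim' x + lim' y = n.-1.
      by case: (zxy z) => -> //; rewrite /y negbK addnC.
    by arith.
  - by move=> z; case: (zxy z) => ->; [rewrite m'x | arith].
have B' : boards_ok (upd (boards c) (site y (fr y))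
    (write (boards c (site y (fr y))) y false (fr y + p))) fr msg'.
  by apply: write_msg_ok => //; arith.
have U a' mv : agent_ok x fr lim' msg' a' -> inv i0
  (@Config n 2 P (upd (boards c) (site y (fr y))
    (write (boards c (site y (fr y))) y false (fr y + p)))
    (upd (agents c) i a') mv) fr lim' msg'.
  move=> ok; apply: (inv_update _ H) => //; first exact: ltnW.
  by right; rewrite -/y; arith.
have hneed : need fr lim' x 1 <= need fr lim x 0.
  by rewrite /need leq_add2r leq_mul2l addn0 addn1 lt orbT.
(* If the companion's frontier is still the homebase, the finisher changes side without moving. *)
case dE: (fr y) => [|d'].
  have yK : ~~ y = x by rewrite /y negbK.
  move: bb; rewrite (turn0 _ _ _ _ _ _ dE) yK => bb.
  apply: (wait_ok E bb) => //; first by rewrite /= yx eqxx.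
  exists fr, lim', msg'; apply: U.
  apply: (@OkExplore _ _ _ _ 0 (lim x + q) f) => //; last by arith.
  - rewrite dE; exact: (@LocAt (state (walk n m x x true 0 _) f) x 0 true).
  - by arith.
have he' : e == Some (~~ (heading y true == cw_port N (site y (fr y)))).
  by move: he; rewrite {1}dE.
have [bp _] := back_port he'.
move: bb; rewrite (turnS _ _ _ _ _ _ dE) => bb.
apply: (go_ok E bb) => //.
move=> f' f'E; left; exists fr, lim', msg'; apply: U.
rewrite bp dE; apply: (@OkReturn _ _ _ _ d' (lim x + q) f') => //.
- exact: LocTransit.
- by rewrite -/y dE.
- by arith.
- by move: h2; have := hn; arith.
Qed.

(** The only phase that can touch the hole, namely when the tested node is the hole. Each crossing
    then costs one unit of [left], and the declaration comes when none remains. *)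
Lemma test_step_ok r (f : 'I_F.+1) :
  located (state (test n m x (fr x) r) f) x (fr x + odd r) (odd r) (agents c i) ->
  r <= m.*2.+1 -> msg x != 0 ->
  r + (n - fr x) + need fr lim x 1 <= f + m.*2 + 2 -> step_ok i0 c x.
Proof.
move Ea: (agents c i) => a L hr h1 h2.
have [G Bo A] := H.
have frn := fr_lt x; have limn := lim_lt x.
have hfr := ghost_fr G x; have hdist := dist_bounds hn hole_home x.
have [mE mlt] := ghost_msg G h1.
have f0 : 0 < f by move: h2; rewrite /need; have := hn; nia.
case: L Ea => [e he|d0] E; last first.
  have pE : prev (fr x + odd r) (odd r) = fr x + ~~ odd r.
    by rewrite /prev; case: (odd r) => /=; arith.
  have [hit|nhit] := eqVneq (fr x).+1 (dist x); last first.
    apply: (arrive_ok H E) => //; rewrite ?pE; try by case: (odd r) => /=; arith.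
      by rewrite !crossings_test ?(negbTE nhit) // ltnW.
    by move=> a' La; apply: (OkTest La).
  pose a' : agent n P := At (state (test n m x (fr x) r) f) (site x (fr x + odd r))
            (Some (~~ (heading x (odd r) == cw_port N (site x (fr x + odd r))))).
  exists (fun b => if b then Killed else a').
    rewrite E; apply: Risky; last by rewrite /= ltn_add2l.
    have cE t : crossings (test n m x (fr x) r) t = r + t.
      by rewrite crossings_test ?hit ?eqxx // ltnW.
    by rewrite /left; rewrite [LHS]cE [X in _ = X.+1]cE addn0 addn1.
  move=> b.
  rewrite (step_transit b E) //; [|case: (odd r); arith|rewrite pE; case: (odd r); arith].
  have -> /= : (prev (fr x + odd r) (odd r) == dist x) || (fr x + odd r == dist x).
    by rewrite pE -hit; case: (odd r) => /=; rewrite ?addn1 ?eqxx ?orbT.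
  split=> //; left; exists fr, lim, msg; apply: inv_agent => //.
  case: b; first exact: OkKilled.
  by apply: (@OkTest _ _ _ _ r f) => //; apply: LocAt; rewrite eqxx orbT.
have bb : brain (test n m x (fr x) r) e (boards c (site x (fr x + odd r))) = _ :=
  brain_test x e (boards c (site x (fr x + odd r))) (ltnW frn) hr.
have {}he : e == Some (~~ (heading x (odd r) == cw_port N (site x (fr x + odd r)))).
  by move: he; case: (odd r) => //=; rewrite addn1.
have [bp _] := back_port he.
case: r hr h2 E bb he bp => [|r] hr h2 E bb he bp; last first.
  apply: (go_ok E bb) => //.
    by rewrite !crossings_test ?(ltnW frn) ?addn0 ?addn1 //; arith.
  move=> f' f'E; left; exists fr, lim, msg; rewrite upd_id; apply: inv_agent => //.
  rewrite bp; apply: (@OkTest _ _ _ _ r f') => //; try arith.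
  have -> : site x (fr x + odd r.+1) = site x (prev (fr x + odd r) (odd r)).
    by congr (site x _); rewrite /prev /=; case: (odd r) => /=; arith.
  have -> : heading x (~~ odd r.+1) = heading x (odd r) by rewrite /= negbK.
  by apply: LocTransit; case: (odd r) => //=; rewrite addn1.
rewrite [odd 0]/= addn0 in E bb bp.
have msE : val ((boards c (site x (fr x))).2 x).2 = lim x.
  by rewrite (boards_msg Bo) ?leqnn //= eqxx.
rewrite /test_step msE in bb.
apply: (go_ok E bb) => //.
  by rewrite crossings_test ?(ltnW frn) //; case: ifP => //; arith.
move=> f' f'E.
have [hit|nhit] := eqVneq (fr x).+1 (dist x).
  right; split; last by rewrite crossings_test ?hit ?eqxx // ltnW.
  apply/existsP; exists x; rewrite -hit /= write_slot //.
  by rewrite !eqxx.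
left; exists (other x (fr x).+1 fr), lim, (other x 0 msg).
have ox T (p : T) g : other x p g x = p by rewrite /other eqxx.
have ony T (p : T) g : other x p g (~~ x) = g (~~ x) by rewrite /other negb_eq.
have lv : level (other x (fr x).+1 fr) lim <= level fr lim.
  apply: level_le => z; have -> : other x (fr x).+1 fr z = fr z + (z == x).
    by rewrite /other; case: (z =P x) => [->|_]; arith.
  by case: z => /=; arith.
apply: (inv_update _ H) => //; last 2 first.
- by rewrite /other eqxx.
- by left; rewrite /other negb_eq.
- split=> z.
  + by rewrite /other; case: (z =P x) => [->|_]; [arith|exact: (ghost_fr G)].
  + have := ghost_lim G z; rewrite /other.
    by case: (z =P x) => [->|_]; arith.
  + exact: (ghost_sum G).
  + rewrite /other; case: (z =P x) => [->|_] //; exact: (ghost_msg G).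
- by apply: mark_ok => //; arith.
- rewrite bp; apply: (@OkExplore _ _ _ _ (fr x).+1 (lim x) f') => //; rewrite ?ox //.
  + exact: LocTransit.
  + exact: ltnW.
  + move: h2; rewrite /need ox f'E.
    have : 4 * n * (level (other x (fr x).+1 fr) lim + 1) <=
           4 * n * (level fr lim + 1) by rewrite leq_mul2l leq_add2r lv orbT.
    have -> : n - fr x = (n - (fr x).+1).+1 by arith.
    by rewrite mulnS; arith.
Qed.

Lemma search_step : ~~ dead (agents c i) -> step_ok i0 c x.
Proof.
move: (inv_agents H x); move Ea: (agents c i) => a ok.
case: ok Ea.
- by move=> h1 h2 h3 h4 Ea _; exact: start_step.
- by move=> d l f b L h1 h2 h3 h4 Ea _; rewrite -Ea in L; exact: explore_step L _ _ _ _.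
- by move=> d f b L h1 h2 h3 h4 Ea _; rewrite -Ea in L; exact: leave_step L _ _ _ _.
- by move=> d f b L h1 h2 h3 h4 Ea _; rewrite -Ea in L; exact: visit_step L _ _ _ _.
- by move=> d l f b L h1 h2 h3 h4 Ea _; rewrite -Ea in L; exact: return_step L _ _ _ _.
- by move=> r f b L h1 h2 h3 Ea _; rewrite -Ea in L; exact: test_step_ok L _ _ _.
- by [].
- by [].
Qed.

End Step.

Lemma dead_reported_or_killed x fr lim msg a : agent_ok x fr lim msg a -> dead a ->
  [/\ a = Killed, msg x != 0 & (fr x).+1 = dist x] \/ a = Reported (~~ x) (dist (~~ x)).
Proof.
have nl s y d o b : located s y d o b -> dead b = false by case.
by case=> [//|d l f b /nl ->|d f b /nl ->|d f b /nl ->|d l f b /nl ->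
  |r f b /nl ->|m0 d0 _|_] //; [left|right].
Qed.

(** * Termination *)

Variable S : scheduler 2.
Hypothesis fuel_enough :
  n + (4 * n * (up_log 2 n + 1) + (m.*2 + 3) * n) <= F.
Local Notation i0 := (S [::]).
Local Notation run := (run N P S).

Lemma init_step b : run [:: b] =
  @Config n 2 P (upd [ffun=> (false, [ffun=> (false, ord0)])] (home N)
      (true, [ffun=> (false, ord0)]))
    (upd [ffun=> At (state None ord_max) (home N) None] i0
       (At (state (walk n m true true true 0 n.-1./2) ord_max) (home N) None)) 0.
Proof.
have E0 : agents (init 2 N P) i0 = At (state None ord_max) (home N) None.
  by rewrite ffunE.
have bb : brain None None (boards (init 2 N P) (home N)) =
    (walk n m true true true 0 n.-1./2,
     (true, [ffun=> (false, ord0)]) : whiteboard n, Wait).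
  by rewrite ffunE.
exact: (step_wait N b E0 bb).
Qed.

(** Sides are assigned by the first access to the homebase, so the invariant starts only after one
    action, and [i0] is whoever the scheduler picks first. *)
Lemma run1 b : exists fr lim msg, inv i0 (run [:: b]) fr lim msg.
Proof.
pose lim x := if x then n.-1./2 else uphalf n.-1.
pose z := fun _ : bool => 0.
have hs : n.-1./2 + uphalf n.-1 = n.-1.
  by rewrite addnC uphalf_half -addnA addnn odd_double_half.
have hh : 0 < n.-1./2 <= uphalf n.-1.
  by rewrite uphalf_half leq_addl half_gt0; have := hn; arith.
have limn x : 0 < lim x < n by rewrite /lim; case: x; have := hn; arith.
have lv : level z lim <= up_log 2 n.
  apply: leq_up_log; rewrite geq_max !subn0.
  by case/andP: (limn true) => _ /ltnW ->; case/andP: (limn false) => _ /ltnW ->.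
have nd x : n + need z lim x 1 <= F.
  apply: leq_trans fuel_enough; rewrite leq_add2l /need subn0 leq_add2r.
  by rewrite leq_mul2l leq_add2r lv orbT.
exists z, lim, z.
rewrite init_step.
have slot v x : ((upd [ffun=> (false, [ffun=> (false, ord0)])] (home N)
    (true, [ffun=> (false, ord0)]) : {ffun 'I_n -> whiteboard n}) v).2 x = (false, ord0).
  by rewrite ffunE; case: eqP => _; rewrite /= ffunE //= ffunE.
split.
- split=> x //; first by case/andP: (dist_bounds hn hole_home x).
  + by have /andP[-> _] := limn x.
  + by case: x; rewrite /lim //= addnC.
- split=> [x d hd|x d hd|]; rewrite ?slot //; first by case: ifP.
  by rewrite ffunE eqxx.
- case; rewrite ffunE /=.
    rewrite eqxx; apply: (@OkExplore _ _ _ _ 0 n.-1./2 ord_max) => //.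
    + exact: (@LocAt _ true 0 true None).
    + by have /andP[_ /ltnW] := limn true.
    + by rewrite subn0.
  have -> : (rev_ord i0 == i0) = false.
    by apply/negbTE; rewrite (inj_eq (@agent_of_inj i0) false true).
  by rewrite ffunE; apply: OkStart => //.
Qed.

(* The hole was declared safe at some time. *)
Fixpoint passed (w : seq bool) : bool :=
  if w is b :: w' then marked (boards (run w)) || passed w' else false.

Lemma inv_step c x b : (exists fr lim msg, inv i0 c fr lim msg) ->
  ~~ marked (boards (step N c (agent_of i0 x) b)) ->
  exists fr lim msg, inv i0 (step N c (agent_of i0 x) b) fr lim msg.
Proof.
move=> [fr [lim [msg H]]].
case D: (dead (agents c (agent_of i0 x))); last first.
  have /negbT/(search_step H)[A _ /(_ b)[_ [//|[-> //]]]] := D.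
move=> _; exists fr, lim, msg; suff -> : step N c (agent_of i0 x) b = c by [].
by rewrite /step; case: (agents c (agent_of i0 x)) D.
Qed.

Lemma run_inv b w : ~~ passed (b :: w) ->
  exists fr lim msg, inv i0 (run (b :: w)) fr lim msg.
Proof.
elim: w b => [|b' w IH] b; first by move=> _; exact: run1.
rewrite [passed _]/= negb_or => /andP[nm np].
rewrite [run _]/=; move: nm; rewrite [run _]/=.
have [x ->] := agent_of_surj i0 (S (b' :: w)).
by move=> nm; apply: inv_step => //; exact: IH.
Qed.

Definition total_rank c := \sum_i rank (agents c i).

Lemma step_rank c i b : (exists fr lim msg, inv i0 c fr lim msg) ->
  step N c i b = c /\ dead (agents c i) \/
  total_rank (step N c i b) < total_rank c.
Proof.
move=> [fr [lim [msg H]]]; have [x ->] := agent_of_surj i0 i.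
case D: (dead (agents c (agent_of i0 x))).
  by left; split=> //; rewrite /step; case: (agents c (agent_of i0 x)) D.
right; have /negbT/(search_step H)[A mA /(_ b)[eA _]] := D.
rewrite /total_rank eA (bigD1 (agent_of i0 x)) //=.
rewrite [X in _ < X](bigD1 (agent_of i0 x)) //=.
rewrite ffunE eqxx -addSn leq_add //.
  by case: mA => [a' _ //|a' _ h]; case: (b) => //=; exact: leq_ltn_trans h.
by apply: leq_sum => j /negbTE ji; rewrite ffunE ji.
Qed.

Definition reported c : bool :=
  [exists i, if agents c i is Reported _ _ then true else false].

(* Two agents killed by the same hole would both have it in their share. *)
Lemma all_dead c : (exists fr lim msg, inv i0 c fr lim msg) ->
  (forall i, dead (agents c i)) -> reported c.
Proof.
move=> [fr [lim [msg [G B A]]]] D.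
have [[_ m1 d1]|E] := dead_reported_or_killed (A true) (D _); last first.
  by apply/existsP; exists (agent_of i0 true); rewrite E.
have [[_ m2 d2]|E] := dead_reported_or_killed (A false) (D _); last first.
  by apply/existsP; exists (agent_of i0 false); rewrite E.
have [_ h1] := ghost_msg G m1; have [_ h2] := ghost_msg G m2.
have := ghost_sum G true; have := dist_sum hn hole_home true.
by rewrite [~~ true]/=; have := hn; arith.
Qed.

Lemma reported_success w : ~~ passed w -> reported (run w) -> success N (run w).
Proof.
case: w => [_ /existsP[i]|b w np rep]; first by rewrite ffunE.
have [fr [lim [msg [G B A]]]] := run_inv np.
have right i y d : agents (run (b :: w)) i = Reported y d -> site y d = hole N.
  move=> E; have [x ix] := agent_of_surj i0 i; subst i.
  have := dead_reported_or_killed (A x); rewrite E => /(_ isT)[[] //|].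
  by case=> -> ->; exact: site_dist.
apply/andP; split.
  case/existsP: rep => i; case E: (agents _ i) => [| | |y d] // _.
  by apply/existsP; exists i; rewrite /reports_right E (right _ _ _ E).
apply/existsPn => i; rewrite /reports_wrong; case E: (agents _ i) => [| | |y d] //.
by rewrite (right _ _ _ E) eqxx.
Qed.

(** Unlike the invariant, this persists under all further coins, as [compactness] requires. *)
Definition settled w := passed w || reported (run w).

Lemma settled_cons b w : settled w -> settled (b :: w).
Proof.
rewrite /settled [passed (_ :: _)]/=; case: (passed w) => [_|/= /existsP[i]].
  by rewrite orbT.
case E: (agents _ i) => [| | |y d] // _; apply/orP; right.
apply/existsP; exists i; rewrite /step.
case D: (agents (Defs.run N P S w) (S w)) => [s v e|s v cw||y' d'].
- case: (trans _ _ _) => [[s' b'] [|x|x d']] /=; rewrite ffunE;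
    case: eqP D => [<-|_ _]; rewrite E //.
- by rewrite /= ffunE; case: eqP D => [<-|_ _]; rewrite E.
- by rewrite E.
- by rewrite E.
Qed.

(** As long as the hole is not declared safe, fairness makes some live agent act and every such
    action lowers the total rank. The descent ends with no live agent, and then one of them has
    reported. *)
Lemma settles (w : nat -> bool) : fair N P S ->
  exists t, settled (rev (mkseq w t)).
Proof.
move=> fairS; set W := fun t => rev (mkseq w t).
have WS t : W t.+1 = w t :: W t by rewrite /W mkseqS rev_rcons.
have [[t pt]|np] := pselect (exists t, passed (W t)).
  by exists t; rewrite /settled pt.
have I t : exists fr lim msg, inv i0 (run (W t.+1)) fr lim msg.
  by rewrite WS; apply: run_inv; rewrite -WS; apply/negP => h; apply: np; exists t.+1.
have D t t' : t <= t' -> run (W t'.+1) = run (W t.+1) \/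
    total_rank (run (W t'.+1)) < total_rank (run (W t.+1)).
  elim: t' => [|t' IH]; first by rewrite leqn0 => /eqP ->; left.
  rewrite leq_eqVlt => /predU1P[->|/IH h]; first by left.
  rewrite [W t'.+2]WS [run (_ :: _)]/=.
  have [[-> _] //|lt] := step_rank (S (W t'.+1)) (w t'.+1) (I t').
  by right; case: h => [<- //|]; apply: ltn_trans.
suff [t rt] : exists t, reported (run (W t.+1)).
  by exists t.+1; rewrite /settled; apply/orP; right.
suff L k t : total_rank (run (W t.+1)) < k ->
    exists t, reported (run (W t.+1)) by exact: (L _ 0 (ltnSn _)).
elim: k t => // k IH t ht.
have [[i /negP ni]|alld] := pselect (exists i, ~ dead (agents (run (W t.+1)) i)); last first.
  exists t; apply: all_dead; first exact: I.
  by move=> i; apply: contrapT => h; apply: alld; exists i.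
have [t' [tt' hS]] := fairS w i t.+1.
case: t' tt' hS => // t' tt' hS.
have [e|lt] := D t t' tt'; last by apply: (IH t'); exact: leq_trans lt ht.
apply: (IH t'.+1).
rewrite WS [run (_ :: _)]/=.
have [[_ dd]|lt] := step_rank (S (W t'.+1)) (w t'.+1) (I t'); last first.
  by apply: leq_trans lt _; rewrite e; exact: ht.
case: hS => hS.
  by move: dd; rewrite [S _]hS e (negbTE ni).
by move: hS; rewrite /inactive -/(W t'.+1) e; move: ni; rewrite /dead => /negbTE ->.
Qed.

(** * Probability of failure *)

Section Risk.
Local Open Scope ring_scope.
Variables (R : realType) (q : R).
Hypothesis hq : 0 <= q <= 1.

(** The probability of surviving the [left a] crossings that remain. *)
Definition weight a : R := if dead a then 0 else (1 - q) ^+ left a.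

Lemma weight_bounds a : 0 <= weight a <= 1.
Proof.
case/andP: hq => q0 q1; rewrite /weight; case: ifP => _; first by rewrite lexx ler01.
by rewrite exprn_ge0 ?exprn_ile1 ?subr_ge0 // gerBl.
Qed.

(* A supermartingale that dominates the probability of declaring the hole safe. *)
Definition risk (w : seq bool) : R :=
  if passed w then 1 else \sum_i weight (agents (run w) i).

Lemma inv_unmarked c : (exists fr lim msg, inv i0 c fr lim msg) ->
  marked (boards c) = false.
Proof.
move=> [fr [lim [msg [G B A]]]]; apply/negbTE/existsPn => x.
have := ghost_fr G x; have := dist_bounds hn hole_home x => h1 h2.
by rewrite (boards_mark B); arith.
Qed.

(** A risky crossing survives with probability 1-q and lowers the exponent by one, so the two
    effects cancel. *)
Lemma weight_move a A : ~~ dead a -> move_spec a A ->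
  q * weight (A true) + (1 - q) * weight (A false) <= weight a.
Proof.
case/andP: hq => q0 q1 da; case=> [a' h _|a' h _].
  have -> : q * weight a' + (1 - q) * weight a' = weight a' by ring.
  rewrite /weight (negbTE da); case: (dead a') h => [_|/= h].
    by rewrite exprn_ge0 // subr_ge0.
  by apply: ler_wiXn2l; rewrite ?subr_ge0 ?gerBl.
rewrite [weight Killed]/weight /= mulr0 add0r /weight (negbTE da) h exprS.
rewrite ler_wpM2l ?subr_ge0 //; case: ifP => // _; rewrite exprn_ge0 // subr_ge0 //.
Qed.

Lemma risk_nil : risk [::] = (1 - q) ^+ m.*2.+2 *+ 2.
Proof.
rewrite /risk /= (eq_bigr (fun=> (1 - q) ^+ m.*2.+2)) ?sumr_const ?card_ord // => i _.
by rewrite ffunE.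
Qed.

Lemma risk_supermartingale w :
  q * risk (true :: w) + (1 - q) * risk (false :: w) <= risk w.
Proof.
case/andP: (hq) => q0 q1.
have convex v u : (forall b : bool, v b <= u) -> q * v true + (1 - q) * v false <= u.
  move=> h; have := ler_wpM2l q0 (h true).
  have h1 : 0 <= 1 - q by rewrite subr_ge0.
  by have := ler_wpM2l h1 (h false); lra.
case pw: (passed w).
  apply: (convex (fun b => risk (b :: w))) => b.
  by rewrite /risk [passed (_ :: _)]/= pw orbT.
case: w pw => [_|b0 w0 pw].
  apply: (convex (fun b => risk (b :: [::]))) => b.
  rewrite risk_nil /risk [passed _]/= inv_unmarked; last exact: run1.
  rewrite init_step (eq_bigr (fun=> (1 - q) ^+ m.*2.+2)) ?sumr_const ?card_ord // => i _.
  by rewrite ffunE; case: eqP => // _; rewrite ffunE.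
set w := b0 :: w0 in pw *.
have I : exists fr lim msg, inv i0 (run w) fr lim msg by apply: run_inv; rewrite pw.
have [x Sx] := agent_of_surj i0 (S w).
have runE b : run (b :: w) = step N (run w) (agent_of i0 x) b by rewrite -Sx.
have pE b : passed (b :: w) = marked (boards (run (b :: w))).
  by rewrite -[LHS]/(marked (boards (run (b :: w))) || passed w) pw orbF.
clearbody w.
case D: (dead (agents (run w) (agent_of i0 x))).
  apply: (convex (fun b => risk (b :: w))) => b.
  have E : run (b :: w) = run w.
    rewrite runE /step.
    by case: (agents (run w) (agent_of i0 x)) D.
  by rewrite /risk pE E inv_unmarked // pw.
case: (I) => fr [lim [msg H]].
have [A mA hA] := search_step H (negbT D).
set a := agents (run w) (agent_of i0 x) in D mA hA.
pose O := \sum_(j | j != agent_of i0 x) weight (agents (run w) j).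
have O0 : 0 <= O by apply: sumr_ge0 => j _; case/andP: (weight_bounds (agents (run w) j)).
have risk_w : risk w = weight a + O by rewrite /risk pw (bigD1 (agent_of i0 x)).
have sumE b : \sum_i weight (agents (run (b :: w)) i) = weight (A b) + O.
  rewrite runE (hA b).1 (bigD1 (agent_of i0 x)) //= ffunE eqxx.
  by congr (_ + _); apply: eq_bigr => j /negbTE ji; rewrite ffunE ji.
(* Either the acting agent has weight 1, and the risk is already at least 1, or this action cannot
   mark the hole. *)
have [l0|l0] := eqVneq (left a) 0%N.
  have wa : weight a = 1 by rewrite /weight D l0.
  apply: (convex (fun b => risk (b :: w))) => b; rewrite risk_w wa /risk.
  case: ifP => _; first by rewrite lerDl.
  by rewrite sumE lerD2r; case/andP: (weight_bounds (A b)).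
have rE b : risk (b :: w) = weight (A b) + O.
  rewrite /risk pE.
  have -> : marked (boards (run (b :: w))) = false.
    by rewrite runE; have [_ [/inv_unmarked //|[_ /eqP]]] := hA b; rewrite (negbTE l0).
  exact: sumE.
have := weight_move (negbT D) mA.
by rewrite risk_w !rE; lra.
Qed.

(** At a settled time, [1 - risk] is 0 if the hole was declared safe, and otherwise at most 1 while
    the report is correct; so it is bounded by the indicator of success. *)
Lemma search_success : fair N P S -> exists T : nat, forall t : nat, (T <= t)%N ->
  1 - (1 - q) ^+ m.*2.+2 *+ 2 <= prob q t (fun w => success N (run w)).
Proof.
move=> /settles hS.
have [T hT] := compactness settled_cons hS.
exists T => t Tt; rewrite -risk_nil.
apply: (submartingale_le_prob hq (g := fun w => 1 - risk w)) => w.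
  by have := risk_supermartingale w; lra.
move=> sw; have := hT w; rewrite sw /settled => /(_ Tt).
rewrite /risk; case: (boolP (passed w)) => [_ _|pw /= rep]; first by rewrite subrr ler0n.
rewrite reported_success // gerBl; apply: sumr_ge0 => i _.
by case/andP: (weight_bounds (agents (run w) i)).
Qed.

End Risk.
End Invariant.

(** * Size of the protocol and choice of the constants *)

Definition fuel_for (m n : nat) : nat :=
  n + (4 * n * (up_log 2 n + 1) + (m.*2 + 3) * n).

(** With L the logarithm, at least 1, the terms are at most nL, 4n(L+2) <= 12nL and (2m+3)nL, whence
    2m+16. *)
Lemma fuel_for_le m n : 2 < n -> fuel_for m n <= (m.*2 + 16) * (n * trunc_log 2 n).
Proof.
move=> hn.
have hl : 0 < trunc_log 2 n by rewrite trunc_log_gt0 /=; lia.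
have hu : up_log 2 n <= (trunc_log 2 n).+1.
  rewrite up_log_trunc_log ?ltnS //; last by lia.
  by apply: leq_trunc_log; lia.
rewrite /fuel_for; set L := trunc_log 2 n in hl hu *; set U := up_log 2 n in hu *.
have : 4 * n * (U + 1) <= 4 * n * (L + 2) by rewrite leq_mul2l; lia.
have : n <= n * L by rewrite leq_pmulr.
have : (m.*2 + 3) * n <= (m.*2 + 3) * (n * L) by rewrite leq_mul2l leq_pmulr ?orbT.
by lia.
Qed.

Lemma leq_expn_self n k : 1 < n -> k <= n ^ k.
Proof. by move=> hn; exact/ltnW/ltn_expl. Qed.

Lemma card_whiteboard n : 2 < n -> #|whiteboard n| <= n ^ 7.
Proof.
move=> hn; rewrite card_prod card_ffun card_prod card_bool card_ord.
have h : 2 * n.+1 <= n ^ 3 by rewrite !expnS expn0; nia.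
by rewrite [n ^ 7]expnS leq_mul //; [lia | rewrite (expnM n 3 2) leq_exp2r].
Qed.

Lemma card_task n m : 2 < n -> #|{: option (task n m)}| <= n ^ (2 * m + 8).
Proof.
move=> hn; rewrite card_option card_sum !card_prod card_bool !card_ord.
have h1 : n.+1 <= n ^ 2 by rewrite !expnS expn0; nia.
have h2 : 2 * 2 * 2 * n.+1 * n.+1 <= n ^ 6.
  rewrite -mulnA; apply: (@leq_trans (n ^ 2 * (n ^ 2 * n ^ 2))).
    apply: leq_mul; last exact: leq_mul.
    by rewrite !expnS expn0; nia.
  by rewrite -!expnD.
have h3 : 2 * n.+1 * m.*2.+2 <= n ^ (2 * m + 5).
  have -> : 2 * m + 5 = 1 + 2 + m.*2.+2 by lia.
  rewrite !expnD; apply: leq_mul; last by apply: leq_expn_self; lia.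
  by apply: leq_mul => //; rewrite expn1; lia.
have h4 : n ^ 6 <= n ^ (2 * m + 7) by rewrite leq_exp2l; lia.
have h5 : n ^ (2 * m + 5) <= n ^ (2 * m + 7) by rewrite leq_exp2l; lia.
have h6 : 1 <= n ^ (2 * m + 7) by rewrite expn_gt0; lia.
have -> : 2 * m + 8 = (2 * m + 7).+1 by lia.
rewrite expnS; nia.
Qed.

(** The move counter stays polynomial in [n], so the memory has O(log n) bits for fixed [m]. *)
Lemma card_memory n m : 2 < n ->
  #|memory (ring_search n m (fuel_for m n))| <= n ^ (4 * m + 30).
Proof.
move=> hn.
have -> : #|memory (ring_search n m (fuel_for m n))| =
  #|{: option (task n m)}| * (fuel_for m n).+1 by rewrite card_prod card_ord.
have -> : 4 * m + 30 = (2 * m + 8) + (2 * m + 22) by lia.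
rewrite expnD leq_mul ?card_task //.
have hl : trunc_log 2 n <= n.
  apply: leq_trans (trunc_logP (p := 2) (n := n) isT _); last by lia.
  exact: leq_expn_self.
have -> : 2 * m + 22 = m.*2 + 17 + 5 by lia.
have h1 := fuel_for_le m hn.
have h2 : (m.*2 + 16) * (n * trunc_log 2 n) <= (m.*2 + 16) * (n * n).
  by rewrite leq_mul2l leq_mul2l hl !orbT.
have h3 : m.*2 + 17 <= n ^ (m.*2 + 17) by apply: leq_expn_self; lia.
rewrite expnD; apply: (@leq_trans ((m.*2 + 17) * n ^ 5)); last by rewrite leq_mul2r h3 orbT.
have h4 : n * n <= n ^ 5 by rewrite -[n * n]/(n ^ 2) leq_exp2l; lia.
have h5 : 0 < n * n by rewrite muln_gt0; lia.
nia.
Qed.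

Local Open Scope ring_scope.

Theorem corollary2 (R : realType) (delta p : R)
    (hdelta : 0 < delta) (hp0 : 0 < p) (hp1 : p <= 1) :
  exists K C c : nat, forall n : nat, (3 <= n)%N ->
  exists (k : nat) (P : protocol),
    [/\ (0 < k <= K)%N,
        (#|board P| <= n ^ c)%N,
        (#|memory P| <= n ^ c)%N &
        forall (N : network n) (q : R) (S : scheduler k),
          hole N != home N -> p <= q <= 1 -> fair N P S ->
          (forall w : seq bool,
             (moves (run N P S w) <= C * (n * trunc_log 2 n))%N) /\
          (exists T : nat, forall t : nat, (T <= t)%N ->
             1 - delta <= prob q t (fun w => success N (run N P S w)))].
Proof.
have [m hm] : exists m : nat, (1 - p) ^+ m.*2.+2 *+ 2 <= delta.
  by apply: small_power; rewrite ?hp0.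
exists 2%N, (m.*2 + 16).*2%N, (4 * m + 30)%N => n hn.
exists 2%N, (ring_search n m (fuel_for m n)); split=> //.
- apply: leq_trans (card_whiteboard hn) _; rewrite leq_exp2l; lia.
- exact: card_memory.
move=> N q S hole_home /andP[pq q1] fairS; split=> [w|].
  apply: leq_trans (@moves_le n m (fuel_for m n) 2 N S w) _.
  by rewrite -muln2 -mulnA mulnCA leq_mul2l fuel_for_le.
have q01 : 0 <= q <= 1 by rewrite q1 (le_trans (ltW hp0)).
have [T hT] := search_success hn hole_home (leqnn (fuel_for m n)) q01 fairS.
exists T => t /hT; apply: le_trans; rewrite lerB //.
(* The protocol depends only on the bound [p]; a larger actual [q] makes surviving the tests at the
   hole less likely. *)
apply: le_trans hm; rewrite lerMn2r /=; apply: lerXn2r; rewrite ?nnegrE ?subr_ge0 //.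
by rewrite lerB.
Qed.
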